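(* Let $0<\varepsilon<1$ and let $w:\mathbb{R}\to\mathbb{R}$ be a non-decreasing function with $w(x)\ge1$. There exists an absolute constant $c>0$ such that the following is true. Let $2\le d_1\le d_2\le\dots\le d_k$ be integers, and let $L>0$ and $K>0$ be such that (i) $\sum_{i=1}^kw(d_i)/d_i\le K\left(\sum_{i=1}^k\log d_i/\log d_k\right)\cdot(w(d_1)/d_k)$, and (ii) $\sum_{i=1}^kw(d_i)/d_i\ge L\left(\sum_{i=1}^k\log d_i/\log d_k\right)\cdot(w(d_k)/d_k)$. Let $n=\prod_{i=1}^kd_i$, let $\mathbb{F}$ be a field, let $M_i\in\mathbb{F}^{d_i\times d_i}$ be arbitrary and $M=\bigotimes_{i=1}^kM_i$. Then $$R^{rc}_{\mathbb{F}}(M,2d_k\cdot n^{1-\gamma})\le n^{\varepsilon}\quad\text{where}\quad\gamma=\frac{cL\varepsilon^2}{d_k\log d_k\cdot K^2\log^2(K/\varepsilon)}.$$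
   Context: The row-column rigidity $R^{rc}_{\mathbb{F}}(A,r)$ of $A\in\mathbb{F}^{n\times n}$ is the minimal $t$ for which there exists $Z\in\mathbb{F}^{n\times n}$ with $\operatorname{rank}(A-Z)\le r$ and every row and every column of $Z$ having at most $t$ non-zero entries. $\bigotimes$ is the Kronecker product.
   Formalization: One absolute c for all 0<ε<1 is impossible (K=1, all d_i=2, ε→1 makes γ unbounded), so the formal version gives, for each ε_0<1, a c>0 depending only on ε_0 that works for all 0<ε≤ε_0 and all w, d_i, L, K, F, M_i. *)

(* Defs.v *)
From HB Require Import structures.
From mathcomp Require Import all_boot all_order all_algebra.
From mathcomp Require Import mxtens.
From mathcomp Require Import all_classical all_reals all_analysis.

Set Implicit Arguments.
Unset Strict Implicit.
Unset Printing Implicit Defensive.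

Import Order.TTheory GRing.Theory Num.Theory.
Local Open Scope ring_scope.

Section Rigidity.
Variables (F : fieldType) (n : nat).
Implicit Types (A Z : 'M[F]_n) (t : nat).

Definition rc_sparse Z t : bool :=
  [forall i, (#|[pred j | Z i j != 0%R]| <= t)%N] &&
  [forall j, (#|[pred i | Z i j != 0%R]| <= t)%N].

Variable R : realType.
Implicit Type r : R.

(* The target rank r is real-valued, since it is used with r = 2 d n^(1-g). *)
Definition rc_reducible A r t : Prop :=
  exists Z, (\rank (A - Z))%:R <= r /\ rc_sparse Z t.

(* The minimal t exists whenever r >= 0 (lemma rc_rigidityP); for r < 0 there
   is no admissible Z and the value is the default 0. *)
Definition rc_rigidity A r : nat :=
  xget 0%N [set t | rc_reducible A r t /\
                    forall s, rc_reducible A r s -> (t <= s)%N]%classic.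

Lemma rc_rigidityP A r : 0 <= r ->
  rc_reducible A r (rc_rigidity A r) /\
  forall s, rc_reducible A r s -> (rc_rigidity A r <= s)%N.
Proof.
move=> r0.
have exn : exists t, `[< rc_reducible A r t >].
  exists n; apply/asboolP; exists A; rewrite subrr mxrank0; split=> //.
  by apply/andP; split; apply/forallP => i;
    rewrite (leq_trans (max_card _)) // card_ord.
have [t /asboolP rt tmin] := ex_minnP exn.
rewrite /rc_rigidity; case: xgetP => [s _ //|/(_ t)] /= [].
by split=> // s rs; apply: tmin; apply/asboolP.
Qed.

End Rigidity.

(* M_0 (x) (M_1 (x) (... (x) M_(k-1))), the empty product being the 1 x 1
   identity. *)
Fixpoint kronmx (F : fieldType) (k : nat) :
    forall (d : 'I_k -> nat), (forall i, 'M[F]_(d i)) ->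
    'M[F]_(\prod_(i < k) d i)%N :=
  match k return forall (d : 'I_k -> nat), (forall i, 'M[F]_(d i)) ->
    'M[F]_(\prod_(i < k) d i)%N with
  | 0 => fun d _ => 1%:M
  | k'.+1 => fun d M =>
      let e : (d ord0 * \prod_(i < k') d (lift ord0 i))%N =
              (\prod_(i < k'.+1) d i)%N := esym (big_ord_recl _ _) in
      castmx (e, e) (tensmx (M ord0) (kronmx (fun i => M (lift ord0 i))))
  end.

(* Main.v *)
Require Import Defs.
From mathcomp Require Import all_boot all_order all_algebra.
From mathcomp Require Import fingroup perm.
From mathcomp Require Import mxtens.
From mathcomp Require Import all_classical all_reals all_analysis.
From mathcomp Require Import ring lra.

(* By the PLU decomposition every factor M_i is a permutation matrix times 2 d_k
   matrices that differ from the identity in a single column (padding with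
   identities when d_i < d_k). Kronecker products commute with matrix products,
   and under matrix products the target ranks add up while the sparsities
   multiply, so it suffices to treat a Kronecker product E of matrices E_i that
   differ from the identity only in column J_i.

   Weight an index x, read as a digit vector, by phi(x) = sum of w(d_i) over the
   i with x_i = J_i. Its mean is mu = sum_i w(d_i) / d_i, and a Chernoff bound
   shows that deviations of delta mu have density at most
   exp(- delta^2 mu / (8 w(d_k))). Delete the rows with small phi and the
   columns with large phi. If E(x, y) <> 0 then y arises from x by changing some
   digits to J_i, which raises phi by at least w(d_1) per change; hence the
   surviving entries lie within Hamming distance 2 delta mu / w(d_1) of the
   diagonal, and an exponential moment bounds the size of such a Hamming ball.
   Hypothesis (i) controls this distance and hypothesis (ii) the number of
   deleted lines. *)

Import Order.TTheory GRing.Theory Num.Theory.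
Local Open Scope ring_scope.

Set Implicit Arguments.
Unset Strict Implicit.
Unset Printing Implicit Defensive.

(** * Mixed-radix digits of the indices of a Kronecker product *)

Definition lift0_rect k (P : 'I_k.+1 -> Type) (p0 : P ord0)
    (ps : forall i, P (lift ord0 i)) (i : 'I_k.+1) : P i :=
  match unliftP ord0 i with
  | UnliftSome j e => ecast x (P x) (esym e) (ps j)
  | UnliftNone e => ecast x (P x) (esym e) p0
  end.

Lemma lift0_rect_ord0 k (P : 'I_k.+1 -> Type) (p0 : P ord0) ps :
  lift0_rect p0 ps ord0 = p0.
Proof.
rewrite /lift0_rect; case: unliftP => [j e|e]; first by have := congr1 val e.
by rewrite (eq_axiomK e).
Qed.

Lemma lift0_rect_lift k (P : 'I_k.+1 -> Type) (p0 : P ord0) ps i :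
  lift0_rect p0 ps (lift ord0 i) = ps i.
Proof.
rewrite /lift0_rect; case: unliftP => [j e|e]; last by have := congr1 val e.
have ij := lift_inj e; move: e; rewrite -ij => e.
by rewrite (eq_axiomK e).
Qed.

Definition unindex0 k (d : 'I_k.+1 -> nat) (a : 'I_(\prod_(i < k.+1) d i)%N) :
    'I_(d ord0) * 'I_(\prod_(i < k) d (lift ord0 i))%N :=
  mxtens_unindex (cast_ord (big_ord_recl k d) a).

Lemma unindex0_bij k (d : 'I_k.+1 -> nat) : bijective (@unindex0 k d).
Proof.
exists (fun p => cast_ord (esym (big_ord_recl k d)) (mxtens_index p)) => x.
  by rewrite /unindex0 mxtens_unindexK cast_ordK.
by rewrite /unindex0 cast_ordKV mxtens_indexK.
Qed.

Fixpoint digit k : forall (d : 'I_k -> nat),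
    'I_(\prod_(i < k) d i)%N -> forall i, 'I_(d i) :=
  match k return forall (d : 'I_k -> nat),
    'I_(\prod_(i < k) d i)%N -> forall i, 'I_(d i) with
  | 0 => fun d _ i => False_rect _ (notF (ltn_ord i))
  | k'.+1 => fun d a => lift0_rect (unindex0 a).1 (digit (unindex0 a).2)
  end.

Lemma digit_ord0 k (d : 'I_k.+1 -> nat) (a : 'I_(\prod_(i < k.+1) d i)%N) :
  digit a ord0 = (unindex0 a).1.
Proof. exact: lift0_rect_ord0. Qed.

Lemma digit_lift k (d : 'I_k.+1 -> nat) (a : 'I_(\prod_(i < k.+1) d i)%N) i :
  digit a (lift ord0 i) = digit (unindex0 a).2 i.
Proof. exact: lift0_rect_lift. Qed.

Arguments digit : simpl never.

Lemma digit_inj k (d : 'I_k -> nat) (a b : 'I_(\prod_(i < k) d i)%N) :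
  (forall i, digit a i = digit b i) -> a = b.
Proof.
elim: k d a b => [|k IH] d a b ab.
  apply: val_inj => /=; move: (ltn_ord a) (ltn_ord b).
  by rewrite {2 4}big_ord0 !ltnS !leqn0 => /eqP-> /eqP->.
apply: (bij_inj (unindex0_bij d)).
rewrite [LHS]surjective_pairing [RHS]surjective_pairing; congr pair.
  by rewrite -!digit_ord0.
by apply: IH => i; rewrite -!digit_lift.
Qed.

Lemma sum_prod_digit (R : comPzSemiRingType) k (d : 'I_k -> nat)
    (g : forall i, 'I_(d i) -> R) :
  \sum_a \prod_i g i (digit a i) = \prod_i \sum_j g i j.
Proof.
elim: k d g => [|k IH] d g.
  rewrite [RHS]big_ord0 (eq_bigr (fun=> 1)) => [|a _]; last by rewrite big_ord0.
  by rewrite sumr_const card_ord {1}big_ord0.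
rewrite [RHS]big_ord_recl /= -IH big_distrlr /= pair_bigA /=.
rewrite [RHS](reindex _ (onW_bij _ (unindex0_bij d))).
apply: eq_bigr => a _; rewrite [LHS]big_ord_recl digit_ord0; congr (_ * _).
by apply: eq_bigr => i _; rewrite digit_lift.
Qed.

Definition hamming k (d : 'I_k -> nat) (a b : 'I_(\prod_(i < k) d i)%N) : nat :=
  #|[pred i | digit a i != digit b i]|.

Lemma hammingC k (d : 'I_k -> nat) (a b : 'I_(\prod_(i < k) d i)%N) :
  hamming a b = hamming b a.
Proof. by apply: eq_card => i; rewrite !inE eq_sym. Qed.

(** * Kronecker products *)

Lemma prod_nth1 (R : pzRingType) (s : seq R) m : (size s <= m)%N ->
  \prod_(j < m) nth 1 s j = \prod_(x <- s) x.
Proof.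
move=> sm; rewrite [RHS](big_nth 1) big_mkord.
rewrite [RHS](big_ord_widen m (nth 1 s)) // [RHS]big_mkcond.
by apply: eq_bigr => j _; case: ltnP => // /(nth_default 1).
Qed.

Section Kronecker.
Variables (F : fieldType) (k : nat) (d : 'I_k -> nat).
Implicit Types A B M : forall i, 'M[F]_(d i).

Lemma eq_kronmx A B : (forall i, A i = B i) -> kronmx A = kronmx B.
Proof. by move=> AB; congr kronmx; apply: functional_extensionality_dep. Qed.

Lemma kronmxE M a b : kronmx M a b = \prod_(i < k) M i (digit a i) (digit b i).
Proof.
elim: k d M a b => [|k' IH] d' M a b.
  rewrite [RHS]big_ord0 /= mxE; suff -> : a = b by rewrite eqxx.
  by apply: digit_inj; case.
rewrite [RHS]big_ord_recl [LHS]castmxE /tensmx mxE IH !digit_ord0 !esymK.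
by congr (_ * _); apply: eq_bigr => i _; rewrite !digit_lift.
Qed.

Lemma kronmx_neq0 M a b :
  (kronmx M a b != 0) = [forall i, M i (digit a i) (digit b i) != 0].
Proof.
rewrite kronmxE; by apply/prodf_neq0/forallP => M0 i; have := M0 i; auto.
Qed.

Lemma kronmx_mul A B : kronmx (fun i => A i *m B i) = kronmx A *m kronmx B.
Proof.
apply/matrixP => a b; rewrite kronmxE mxE.
under [RHS]eq_bigr do rewrite !kronmxE -big_split.
rewrite (sum_prod_digit (fun i j => A i (digit a i) j * B i j (digit b i))).
by apply: eq_bigr => i _; rewrite mxE.
Qed.

Lemma kronmx_tr M : (kronmx M)^T = kronmx (fun i => (M i)^T).
Proof.
apply/matrixP => a b; rewrite mxE !kronmxE.
by apply: eq_bigr => i _; rewrite mxE.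
Qed.

Lemma kronmx1 : kronmx (fun i => 1%:M : 'M[F]_(d i)) = 1%:M.
Proof.
apply/matrixP => a b; rewrite kronmxE mxE.
have [->|ab] := eqVneq a b; first by rewrite big1 // => i _; rewrite mxE eqxx.
have [i dab] : exists i, digit a i != digit b i.
  apply/existsP; rewrite -negb_forall; apply: contra ab => /forallP ab.
  by apply/eqP/digit_inj => i; apply/eqP.
by rewrite (bigD1 i) //= mxE (negPf dab) mul0r.
Qed.

Lemma kronmx_prod m (A : nat -> forall i, 'M[F]_(d i)) :
  kronmx (fun i => \prod_(j < m) A j i) = \prod_(j < m) kronmx (A j).
Proof.
elim: m => [|m IH].
  by rewrite big_ord0 -[RHS]kronmx1; apply: eq_kronmx => i; rewrite big_ord0.
rewrite big_ord_recr -IH -[RHS]kronmx_mul.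
by apply: eq_kronmx => i; rewrite big_ord_recr.
Qed.

Lemma kronmx_prod_seq m (Es : forall i, seq 'M[F]_(d i)) :
  (forall i, size (Es i) <= m)%N ->
  kronmx (fun i => \prod_(E <- Es i) E) =
  \prod_(j < m) kronmx (fun i => nth 1%:M (Es i) j).
Proof.
move=> sm; rewrite -(kronmx_prod m (fun j i => nth 1%:M (Es i) j)).
apply: eq_kronmx => i.
by rewrite -(prod_nth1 (sm i)).
Qed.

End Kronecker.

(** * Sparsity *)

Lemma leq_card_bigcup (I T : finType) (P : pred I) (A : I -> {set T}) :
  (#|\bigcup_(i | P i) A i| <= \sum_(i | P i) #|A i|)%N.
Proof.
elim/big_ind2: _ => [|m X n Y Xm Yn|//]; first by rewrite cards0.
by rewrite (leq_trans (leq_card_setU X Y)) ?leq_add.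
Qed.

Section RowSparse.
Variable F : fieldType.

Definition row_sparse m n (Z : 'M[F]_(m, n)) (t : nat) : bool :=
  [forall i, (#|[pred j | Z i j != 0%R]| <= t)%N].

Lemma rc_sparseE n (Z : 'M[F]_n) t :
  rc_sparse Z t = row_sparse Z t && row_sparse Z^T t.
Proof.
congr andb; apply: eq_forallb => i; congr (_ <= _)%N.
by apply: eq_card => j; rewrite !inE mxE.
Qed.

Lemma row_sparse_perm n (s : 'S_n) : row_sparse (perm_mx s : 'M[F]_n) 1.
Proof.
apply/forallP => i; rewrite -(card1 (s i)).
apply/subset_leq_card/fintype.subsetP => j.
by rewrite !inE !mxE; case: (s i =P j) => [->|]; rewrite ?eqxx.
Qed.

Lemma row_sparse_mul m n p (A : 'M[F]_(m, n)) (B : 'M[F]_(n, p)) s t :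
  row_sparse A s -> row_sparse B t -> row_sparse (A *m B) (s * t).
Proof.
move=> /forallP As /forallP Bt; apply/forallP => i.
have supp_sub : [set j | (A *m B) i j != 0] \subset
    \bigcup_(l in [pred l | A i l != 0]) [set j | B l j != 0].
  apply/fintype.subsetP => j; rewrite inE mxE; apply: contraNT => nAB.
  rewrite big1 // => l _; apply/eqP; apply: contraNT nAB.
  by rewrite mulf_eq0 => /norP[Al Bl]; apply/bigcupP; exists l; rewrite inE.
rewrite -cardsE (leq_trans (subset_leq_card supp_sub)) //.
apply: leq_trans (leq_card_bigcup _ _) _.
apply: (@leq_trans (\sum_(l in [pred l | A i l != 0%R]) t)%N).
  by apply: leq_sum => l _; rewrite cardsE Bt.
by rewrite sum_nat_const leq_mul2r As orbT.
Qed.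

Lemma row_sparse_kron k (d : 'I_k -> nat) (M : forall i, 'M[F]_(d i)) t :
  (forall i, row_sparse (M i) (t i)) -> row_sparse (kronmx M) (\prod_i t i).
Proof.
move=> Mt; apply/forallP => a.
have -> : #|[pred b | kronmx M a b != 0]| =
    \prod_i \sum_j (M i (digit a i) j != 0 : nat).
  rewrite -(sum_prod_digit (fun i j => (M i (digit a i) j != 0 : nat))).
  rewrite -sum1_card big_mkcond; apply: eq_bigr => b _; rewrite inE kronmx_neq0.
  case: forallP => [M0|/forallP/forallPn[i /negPf Mi]].
    by rewrite big1 // => i _; rewrite M0.
  by rewrite (bigD1 i) //= Mi mul0r.
apply: leq_prod => i _; have /forallP/(_ (digit a i)) := Mt i.
by rewrite -sum1_card big_mkcond.
Qed.

End RowSparse.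

Section RowColumnSparse.
Variable F : fieldType.

Lemma rc_sparse_perm n (s : 'S_n) : rc_sparse (perm_mx s : 'M[F]_n) 1.
Proof. by rewrite rc_sparseE tr_perm_mx !row_sparse_perm. Qed.

Lemma rc_sparse_mul n (A B : 'M[F]_n) s t :
  rc_sparse A s -> rc_sparse B t -> rc_sparse (A *m B) (s * t).
Proof.
rewrite !rc_sparseE trmx_mul => /andP[As Ats] /andP[Bt Btt].
by rewrite row_sparse_mul //= mulnC row_sparse_mul.
Qed.

Lemma rc_sparse_kron k (d : 'I_k -> nat) (M : forall i, 'M[F]_(d i)) t :
  (forall i, rc_sparse (M i) (t i)) -> rc_sparse (kronmx M) (\prod_i t i).
Proof.
move=> Mt; rewrite rc_sparseE kronmx_tr !row_sparse_kron // => i.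
  by have := Mt i; rewrite rc_sparseE => /andP[].
by have := Mt i; rewrite rc_sparseE => /andP[].
Qed.

End RowColumnSparse.

(** * Reduction to low rank *)

Lemma mxrank_row_supp (F : fieldType) m n (A : 'M[F]_(m, n)) (S : pred 'I_m) :
  (forall i j, A i j != 0 -> S i) -> (\rank A <= #|S|)%N.
Proof.
move=> AS; pose B : 'M[F]_(m, #|S|) := \matrix_(i, l) (i == enum_val l)%:R.
suff -> : A = B *m rowsub enum_val A by apply: mulmx_max_rank.
apply/matrixP => i j; rewrite mxE; under eq_bigr do rewrite !mxE.
rewrite -(big_enum_val (A := S) (fun l => (i == l)%:R * A l j)) big_mkcond /=.
rewrite (bigD1 i) //= big1 ?addr0 => [|l li]; last first.
  by rewrite eq_sym (negPf li) mul0r if_same.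
rewrite eqxx mul1r; case: ifPn => // nSi.
by apply/eqP; apply: contraNT nSi => /AS.
Qed.

Lemma mxrank_cross_supp (F : fieldType) m n (A : 'M[F]_(m, n))
    (S : pred 'I_m) (T : pred 'I_n) :
  (forall i j, A i j != 0 -> S i || T j) -> (\rank A <= #|S| + #|T|)%N.
Proof.
move=> AST; pose B := \matrix_(i, j) (if S i then A i j else 0).
rewrite -[A](addrNK B) addrC (leq_trans (mxrank_add _ _)) // leq_add //.
  by apply: mxrank_row_supp => i j; rewrite mxE; case: (S i); rewrite ?eqxx.
rewrite -mxrank_tr; apply: mxrank_row_supp => j i; rewrite !mxE.
by have := AST i j; case: (S i) => /=; rewrite ?subrr ?eqxx ?subr0.
Qed.

Section Reducible.
Variables (F : fieldType) (n : nat) (R : realType).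
Implicit Types (A B : 'M[F]_n) (r : R).

Lemma rc_reducible_le A r r' t :
  r <= r' -> rc_reducible A r t -> rc_reducible A r' t.
Proof.
by move=> rr' [Z [rZ sZ]]; exists Z; split=> //; apply: le_trans rr'.
Qed.

Lemma rc_sparse_reducible A t : rc_sparse A t -> rc_reducible A (0 : R) t.
Proof. by exists A; rewrite subrr mxrank0. Qed.

Lemma rc_reducible_mul A B r1 r2 t1 t2 :
  rc_reducible A r1 t1 -> rc_reducible B r2 t2 ->
  rc_reducible (A *m B) (r1 + r2) (t1 * t2).
Proof.
move=> [Y [rY sY]] [Z [rZ sZ]]; exists (Y *m Z).
split; last exact: rc_sparse_mul.
have -> : A *m B - Y *m Z = (A - Y) *m B + Y *m (B - Z).
  by rewrite mulmxBl mulmxBr addrA subrK.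
apply: le_trans (lerD rY rZ); rewrite -natrD ler_nat.
rewrite (leq_trans (mxrank_add _ _)) // leq_add //.
  exact: mxrankM_maxl.
exact: mxrankM_maxr.
Qed.

Lemma rc_reducible_prod m (A : 'I_m -> 'M[F]_n) (r : 'I_m -> R) t :
  (forall j, rc_reducible (A j) (r j) (t j)) ->
  rc_reducible (\prod_j A j) (\sum_j r j) (\prod_j t j).
Proof.
move=> Art; elim/big_rec3: _ => [|j B s u _ Bsu]; last exact: rc_reducible_mul.
apply: rc_sparse_reducible.
by rewrite -[X in rc_sparse X]perm_mx1 rc_sparse_perm.
Qed.

Lemma rc_reducible_cross A (S T : pred 'I_n) t :
  rc_sparse (\matrix_(i, j) if S i || T j then 0 else A i j) t ->
  rc_reducible A ((#|S| + #|T|)%:R : R) t.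
Proof.
set Z := \matrix_(_, _) _ => sZ; exists Z; split=> //; rewrite ler_nat.
apply: mxrank_cross_supp => i j; rewrite !mxE.
by case: ifP => // _; rewrite subrr eqxx.
Qed.

Lemma rc_rigidity_le A r t : rc_reducible A r t -> (rc_rigidity A r <= t)%N.
Proof.
move=> red; have r0 : 0 <= r by case: red => Z [rZ _]; apply: le_trans rZ.
by have [_] := rc_rigidityP A r0; apply.
Qed.

Lemma rc_rigidity_eq0 A r : n%:R <= r -> rc_rigidity A r = 0%N.
Proof.
move=> nr; apply/eqP; rewrite -leqn0; apply: rc_rigidity_le.
exists 0; rewrite subr0; split.
  by apply: le_trans nr; rewrite ler_nat rank_leq_row.
by apply/andP; split; apply/forallP => i;
  rewrite eq_card0 // => j; rewrite !inE mxE eqxx.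
Qed.

End Reducible.

(** * Factorization into matrices that differ from the identity in one column *)

Section ColumnFactors.
Variable R : pzRingType.

Definition offdiag_col n (q : 'I_n) (E : 'M[R]_n) : Prop :=
  forall a b, a != b -> b != q -> E a b = 0.

Definition col_patch n (A : 'M[R]_n) (S : pred 'I_n) : 'M[R]_n :=
  \matrix_(a, b) (if S b then A else 1%:M) a b.

Definition col_factors n (A : 'M[R]_n) (s : seq 'I_n) : seq 'M[R]_n :=
  [seq col_patch A (pred1 q) | q <- s].

Lemma col_factors_offdiag n (A : 'M[R]_n) s E :
  E \in col_factors A s -> exists q, offdiag_col q E.
Proof.
move=> /mapP[q _ ->]; exists q => a b ab bq.
by rewrite mxE /= (negPf bq) mxE (negPf ab).
Qed.

Lemma col_patch_mul n (A : 'M[R]_n) (S T : pred 'I_n) :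
  (forall a b, S a -> T b -> A a b = 0) ->
  col_patch A S *m col_patch A T = col_patch A (predU S T).
Proof.
move=> A0; apply/matrixP => a b; rewrite !mxE /=.
have [Tb|nTb] := boolP (T b); rewrite ?orbT ?orbF.
  rewrite -[in RHS](mul1mx A) [RHS]mxE; apply: eq_bigr => c _; rewrite !mxE Tb.
  by case: ifP => Sc; [rewrite (A0 c b) // !mulr0|rewrite mxE].
transitivity ((col_patch A S *m 1%:M) a b); last by rewrite mulmx1 mxE.
rewrite mxE; apply: eq_bigr => c _.
by rewrite [col_patch A T c b]mxE (negPf nTb).
Qed.

Lemma prod_col_factors n (A : 'M[R]_n) (s : seq 'I_n) :
  pairwise (fun p q => A p q == 0) s ->
  \prod_(E <- col_factors A s) E = col_patch A (mem s).
Proof.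
elim: s => [_|q s IH /andP[/allP A0 /IH {}IH]].
  by rewrite big_nil; apply/matrixP => a b; rewrite !mxE.
rewrite big_cons IH -[LHS]/(_ *m _) col_patch_mul => [|a b /eqP-> /A0/eqP //].
by apply/matrixP => a b; rewrite !mxE.
Qed.

Lemma col_patch_full n (A : 'M[R]_n) (s : seq 'I_n) : s =i 'I_n ->
  col_patch A (mem s) = A.
Proof. by move=> sT; apply/matrixP => a b; rewrite mxE /= sT. Qed.

Lemma prod_col_factors_lower n (A : 'M[R]_n) :
  is_trig_mx A -> \prod_(E <- col_factors A (enum 'I_n)) E = A.
Proof.
move=> /is_trig_mxP A0; rewrite prod_col_factors ?col_patch_full // => [q|].
  by rewrite mem_enum.
apply: (@sub_pairwise _ (relpre val ltn)) => [a b /A0 -> //|].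
rewrite -pairwise_map val_enum_ord -sorted_pairwise ?iota_ltn_sorted //.
exact: ltn_trans.
Qed.

Lemma prod_col_factors_upper n (A : 'M[R]_n) :
  is_trig_mx A^T -> \prod_(E <- col_factors A (rev (enum 'I_n))) E = A.
Proof.
move=> /is_trig_mxP A0; rewrite prod_col_factors ?col_patch_full // => [q|].
  by rewrite mem_rev mem_enum.
apply: (@sub_pairwise _ (relpre val gtn)) => [a b /A0|].
  by rewrite mxE => ->.
rewrite -pairwise_map map_rev val_enum_ord -sorted_pairwise ?rev_sorted.
  exact: iota_ltn_sorted.
by move=> a b c /= ba /ltn_trans; apply.
Qed.

End ColumnFactors.

Lemma plu_col_factors (F : fieldType) n (A : 'M[F]_n) :
  exists sEs : 'S_n * seq 'M[F]_n,
    [/\ A = perm_mx sEs.1 *m \prod_(E <- sEs.2) E, size sEs.2 = (n + n)%N &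
        forall E, E \in sEs.2 -> exists q, offdiag_col q E].
Proof.
case: n A => [|n] A.
  by exists (1%g, [::]); split=> //; apply/matrixP => -[].
have /is_perm_mxP[s Ps] := cormen_lup_perm A.
have := cormen_lup_correct A.
have := @cormen_lup_lower F n A; have := @cormen_lup_upper F n A; move: Ps.
case: (cormen_lup A) => [[P L] U] /= -> U0 L1 PA.
exists (s^-1%g,
  col_factors L (enum 'I_n.+1) ++ col_factors U (rev (enum 'I_n.+1))).
split=> /=.
- have trigU : is_trig_mx U^T by apply/is_trig_mxP => a b ab; rewrite mxE U0.
  have trigL : is_trig_mx L.
    by apply/is_trig_mxP => a b ab; rewrite L1 1?ltnW // -val_eqE /= ltn_eqF.
  rewrite big_cat /= prod_col_factors_upper // prod_col_factors_lower //.
  by rewrite -PA mulmxA -perm_mxM mulVg perm_mx1 mul1mx.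
- by rewrite size_cat !size_map size_rev -enumT size_enum_ord.
- by move=> E; rewrite mem_cat => /orP[] /col_factors_offdiag.
Qed.

(** * Exponential moments of digit sums *)

Lemma sum_if_eq (V : nmodType) (T : finType) (z : T) (x y : V) :
  \sum_j (if j == z then x else y) = x + y *+ #|T|.-1.
Proof.
rewrite (bigD1 z) //= eqxx; congr (_ + _).
under eq_bigr => j /negPf -> do []; by rewrite sumr_const cardC1.
Qed.

Lemma expR_le_quadratic (R : realType) (u : R) :
  u <= 1 / 2 -> expR u <= 1 + (u + 2 * u ^+ 2).
Proof.
move=> u2; have u1 : 0 < 1 - u by lra.
rewrite -(ler_pM2r u1); apply: (@le_trans _ _ 1).
  rewrite -[leRHS](expRxMexpNx_1 u) ler_wpM2l ?expR_ge0 //.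
  exact: expR_ge1Dx.
have : 0 <= u ^+ 2 * (1 - 2 * u) by rewrite mulr_ge0 ?sqr_ge0 //; lra.
nra.
Qed.

Lemma sum_expR_if_eq_le (R : realType) n (q : 'I_n) (u : R) : u <= 1 / 2 ->
  \sum_j expR (if j == q then u else 0) <=
  n%:R * expR ((u + 2 * u ^+ 2) / n%:R).
Proof.
case: n q => [[] //|n] q u2.
under eq_bigr do rewrite (fun_if expR) expR0; rewrite sum_if_eq card_ord /=.
have n0 : (0 : R) < n.+1%:R by [].
apply: (@le_trans _ _ (n.+1%:R * (1 + (u + 2 * u ^+ 2) / n.+1%:R))); last first.
  by rewrite ler_pM2l // expR_ge1Dx.
rewrite mulrDr mulr1 mulrCA divff ?gt_eqF // mulr1.
by have := expR_le_quadratic u2; rewrite -natr1; lra.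
Qed.

Section DigitTails.
Variables (R : realType) (k : nat) (d : 'I_k -> nat).
Implicit Types (s c delta theta m : R) (a b : 'I_(\prod_(i < k) d i)%N).

(* Markov's inequality for the exponential of a sum of independent terms. *)
Lemma card_digit_sum_ge (f : forall i, 'I_(d i) -> R) c :
  (#|[pred a | (c <= \sum_i f i (digit a i))%R]|)%:R <=
  expR (- c) * \prod_i \sum_j expR (f i j).
Proof.
rewrite -(sum_prod_digit (fun i j => expR (f i j))) mulr_sumr.
rewrite -sum1_card natr_sum big_mkcond; apply: ler_sum => a _ /=.
rewrite -expR_sum -expRD inE; case: ifP => [ca|_]; last exact: expR_ge0.
by rewrite -[leLHS]expR0 ler_expR addrC subr_ge0.
Qed.

Definition hit_weight (w : 'I_k -> R) (J : forall i, 'I_(d i)) a : R :=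
  \sum_(i | digit a i == J i) w i.

Definition mean_weight (w : 'I_k -> R) : R := \sum_i w i / (d i)%:R.

Definition tail_exponent (w : 'I_k -> R) (hi delta : R) : R :=
  delta ^+ 2 * mean_weight w / (8 * hi).

Section HitWeightTails.
Variables (w : 'I_k -> R) (J : forall i, 'I_(d i)) (hi : R).
Hypotheses (hi_gt0 : 0 < hi) (w_bounds : forall i, 0 <= w i <= hi).

Lemma second_moment_weight_le :
  \sum_i w i ^+ 2 / (d i)%:R <= hi * mean_weight w.
Proof.
rewrite mulr_sumr; apply: ler_sum => i _; have /andP[w0 wh] := w_bounds i.
by rewrite expr2 -mulrA ler_wpM2r // mulr_ge0 ?invr_ge0.
Qed.

Lemma card_scaled_hit_weight_ge s c : s * hi <= 1 / 2 ->
  (#|[pred a | (c <= s * hit_weight w J a)%R]|)%:R <=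
  (\prod_i d i)%N%:R *
    expR (s * mean_weight w + 2 * s ^+ 2 * (hi * mean_weight w) - c).
Proof.
move=> shi.
have sw i : s * w i <= 1 / 2.
  have /andP[w0 wh] := w_bounds i; have [s0|s0] := leP 0 s.
    exact: le_trans (ler_wpM2l s0 wh) shi.
  by apply: (@le_trans _ _ 0); [rewrite nmulr_rle0|lra].
pose f i (j : 'I_(d i)) : R := if j == J i then s * w i else 0.
have fE a : s * hit_weight w J a = \sum_i f i (digit a i).
  by rewrite mulr_sumr big_mkcond.
rewrite (eq_card (B := [pred a | c <= \sum_i f i (digit a i)])) => [|a];
  last by rewrite !inE fE.
apply: le_trans (card_digit_sum_ge f c) _.
apply: (@le_trans _ _ (expR (- c) *
    \prod_i ((d i)%:R * expR ((s * w i + 2 * (s * w i) ^+ 2) / (d i)%:R)))).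
  rewrite ler_wpM2l ?expR_ge0 //; apply: ler_prod => i _.
  by rewrite sum_expR_if_eq_le // sumr_ge0 // => j _; apply: expR_ge0.
rewrite big_split /= -natr_prod -expR_sum [leLHS]mulrC -[leLHS]mulrA.
rewrite ler_wpM2l // -expRD ler_expR lerD2r.
have -> : \sum_i (s * w i + 2 * (s * w i) ^+ 2) / (d i)%:R =
    s * mean_weight w + 2 * s ^+ 2 * \sum_i w i ^+ 2 / (d i)%:R.
  by rewrite !mulr_sumr -big_split; apply: eq_bigr => i _ /=; ring.
by rewrite lerD2l ler_wpM2l ?second_moment_weight_le // mulr_ge0 ?sqr_ge0.
Qed.

Lemma card_hit_weight_ge delta : 0 <= delta <= 1 ->
  (#|[pred a | ((1 + delta) * mean_weight w <= hit_weight w J a)%R]|)%:R <=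
  (\prod_i d i)%N%:R * expR (- tail_exponent w hi delta).
Proof.
move=> /andP[delta0 delta1]; pose s := delta / (4 * hi).
have s0 : 0 <= s by rewrite divr_ge0 // mulr_ge0 // ltW.
have shiE : s * hi = delta / 4 by rewrite /s; field; rewrite gt_eqF.
have shi : s * hi <= 1 / 2 by rewrite shiE; lra.
have := @card_scaled_hit_weight_ge s (s * ((1 + delta) * mean_weight w)) shi.
have -> : s * mean_weight w + 2 * s ^+ 2 * (hi * mean_weight w) -
    s * ((1 + delta) * mean_weight w) = - tail_exponent w hi delta.
  by rewrite /s /tail_exponent; field; rewrite gt_eqF.
apply: le_trans; rewrite ler_nat; apply/subset_leq_card/fintype.subsetP => a.
by rewrite !inE; apply: ler_wpM2l.
Qed.

Lemma card_hit_weight_le delta : 0 <= delta ->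
  (#|[pred a | (hit_weight w J a <= (1 - delta) * mean_weight w)%R]|)%:R <=
  (\prod_i d i)%N%:R * expR (- tail_exponent w hi delta).
Proof.
move=> delta0; pose s := - (delta / (4 * hi)).
have s0 : s <= 0 by rewrite oppr_le0 divr_ge0 // mulr_ge0 // ltW.
have shi : s * hi <= 1 / 2.
  by apply: (@le_trans _ _ 0); [rewrite pmulr_lle0|lra].
have := @card_scaled_hit_weight_ge s (s * ((1 - delta) * mean_weight w)) shi.
have -> : s * mean_weight w + 2 * s ^+ 2 * (hi * mean_weight w) -
    s * ((1 - delta) * mean_weight w) = - tail_exponent w hi delta.
  by rewrite /s /tail_exponent; field; rewrite gt_eqF.
apply: le_trans; rewrite ler_nat; apply/subset_leq_card/fintype.subsetP => a.
by rewrite !inE; apply: ler_wnM2l.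
Qed.

End HitWeightTails.

Definition hamming_ball_bound theta m : R :=
  expR (theta * m + (\sum_i d i)%N%:R * expR (- theta)).

Lemma card_hamming_ball theta m a : 0 <= theta ->
  (#|[pred b | ((hamming a b)%:R <= m)%R]|)%:R <= hamming_ball_bound theta m.
Proof.
move=> theta0.
pose f i (j : 'I_(d i)) : R := if j == digit a i then 0 else - theta.
have fE b : \sum_i f i (digit b i) = - (theta * (hamming a b)%:R).
  rewrite /hamming -sum1_card natr_sum mulr_sumr -sumrN [RHS]big_mkcond.
  apply: eq_bigr => i _; rewrite inE /f eq_sym.
  by case: eqVneq => //= _; rewrite mulr1.
pose nearby := [pred b | (- (theta * m) <= \sum_i f i (digit b i))%R].
apply: (@le_trans _ _ (#|nearby|)%:R).
  rewrite ler_nat; apply/subset_leq_card/fintype.subsetP => b.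
  by rewrite !inE fE lerN2; apply: ler_wpM2l.
apply: le_trans (card_digit_sum_ge f _) _.
rewrite opprK /hamming_ball_bound expRD ler_wpM2l ?expR_ge0 //.
rewrite natr_sum mulr_suml expR_sum; apply: ler_prod => i _.
apply/andP; split; first by apply: sumr_ge0 => j _; apply: expR_ge0.
under eq_bigr do rewrite (fun_if expR) expR0; rewrite sum_if_eq card_ord.
apply: le_trans (expR_ge1Dx _); rewrite lerD2l -[leLHS]mulr_natl.
by rewrite ler_wpM2r ?expR_ge0 // ler_nat leq_pred.
Qed.

Lemma rc_sparse_hamming (F : fieldType) (Z : 'M[F]_(\prod_(i < k) d i)%N)
    theta m :
  0 <= theta -> (forall a b, Z a b != 0 -> (hamming a b)%:R <= m) ->
  rc_sparse Z (Num.truncn (hamming_ball_bound theta m)).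
Proof.
move=> theta0 Zm; apply/andP; split; apply/forallP => a;
  rewrite truncn_ge_nat ?expR_ge0 //;
  apply: le_trans (card_hamming_ball m a theta0); rewrite ler_nat;
  apply/subset_leq_card/fintype.subsetP => b; rewrite !inE => /Zm //.
by rewrite hammingC.
Qed.

End DigitTails.

(** * Rigidity of Kronecker products *)

Section KroneckerRigidity.
Variables (F : fieldType) (R : realType) (k : nat) (d : 'I_k -> nat).
Variables (w : 'I_k -> R) (lo hi : R).
Hypotheses (lo_gt0 : 0 < lo) (le_lo_hi : lo <= hi).
Hypothesis w_bounds : forall i, lo <= w i <= hi.
Variables (delta theta : R).
Hypotheses (delta_bounds : 0 <= delta <= 1) (theta_ge0 : 0 <= theta).

Let n : R := (\prod_(i < k) d i)%N%:R.
Let mu : R := mean_weight d w.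
Let deleted : R := n * expR (- tail_exponent d w hi delta).
Let sparsity : R := hamming_ball_bound d theta (2 * delta * mu / lo).

(* A nonzero entry changes digits only to [J i], gaining weight at least [lo]
   per change. *)
Lemma kronmx_offdiag_col_hamming (E : forall i, 'M[F]_(d i)) J a b :
  (forall i, offdiag_col (J i) (E i)) -> kronmx E a b != 0 ->
  lo * (hamming a b)%:R <= hit_weight w J b - hit_weight w J a.
Proof.
move=> EJ; rewrite kronmx_neq0 => /forallP Eab.
rewrite /hamming -sum1_card natr_sum mulr_sumr lerBrDr /hit_weight.
rewrite big_mkcond [X in _ + X]big_mkcond [leRHS]big_mkcond -big_split.
apply: ler_sum => i _ /=; rewrite inE.
have /andP[wlo _] := w_bounds i; have w0 := le_trans (ltW lo_gt0) wlo.
have [<-|ab] := eqVneq (digit a i) (digit b i); first by rewrite add0r.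
have bJ : digit b i = J i by apply: contra_neq_eq (Eab i) => bJ; apply: EJ.
by rewrite -bJ eqxx (negPf ab) mulr1 addr0.
Qed.

Lemma rc_reducible_kron_offdiag_col (E : forall i, 'M[F]_(d i)) :
  (forall i, exists q, offdiag_col q (E i)) ->
  rc_reducible (kronmx E) (2 * deleted) (Num.truncn sparsity).
Proof.
move=> Ecol; pose J i := sval (cid (Ecol i)).
have EJ i : offdiag_col (J i) (E i) := svalP (cid (Ecol i)).
have hi_gt0 := lt_le_trans lo_gt0 le_lo_hi.
have w_ge0 i : 0 <= w i <= hi.
  by have /andP[lw ->] := w_bounds i; rewrite (le_trans (ltW lo_gt0) lw).
have /andP[delta0 _] := delta_bounds.
pose light := [pred a | (hit_weight w J a <= (1 - delta) * mu)%R].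
pose heavy := [pred a | ((1 + delta) * mu <= hit_weight w J a)%R].
apply: (@rc_reducible_le _ _ _ _ (#|light| + #|heavy|)%:R).
  rewrite natrD mulr_natl mulr2n; apply: lerD.
    exact: card_hit_weight_le.
  exact: card_hit_weight_ge.
apply/rc_reducible_cross/rc_sparse_hamming => // a b; rewrite mxE.
case: ifP; rewrite ?eqxx // => /norP[]; rewrite -!ltNge => heavy_a light_b.
move=> /(kronmx_offdiag_col_hamming EJ) ham.
by rewrite ler_pdivlMr // mulrC; lra.
Qed.

Lemma rc_reducible_kron (M : forall i, 'M[F]_(d i)) D :
  (forall i, 0 < d i <= D)%N ->
  rc_reducible (kronmx M) ((2 * deleted) *+ (D + D))
    (Num.truncn sparsity ^ (D + D)).
Proof.
move=> dD; pose plu i := cid (plu_col_factors (M i)).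
pose s i := (sval (plu i)).1; pose Es i := (sval (plu i)).2.
have MsE i : M i = perm_mx (s i) *m \prod_(E <- Es i) E.
  by have [] := svalP (plu i).
have size_Es i : (size (Es i) <= D + D)%N.
  have [_ -> _] := svalP (plu i); have /andP[_ diD] := dD i; exact: leq_add.
have Es_col j i : exists q, offdiag_col q (nth 1%:M (Es i) j).
  have [jlt|jge] := ltnP j (size (Es i)).
    by have [_ _] := svalP (plu i); apply; rewrite mem_nth.
  have /andP[di0 _] := dD i; exists (Ordinal di0) => a b ab _.
  by rewrite nth_default // mxE (negPf ab).
rewrite (eq_kronmx MsE) kronmx_mul (kronmx_prod_seq size_Es).
rewrite -[X in rc_reducible _ X]add0r -[X in rc_reducible _ _ X]mul1n.
apply: rc_reducible_mul.
  apply: rc_sparse_reducible.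
  have := rc_sparse_kron (fun i => rc_sparse_perm F (s i)).
  by rewrite prod_nat_const exp1n.
have := rc_reducible_prod (fun j : 'I_(D + D) =>
  rc_reducible_kron_offdiag_col (Es_col j)).
by rewrite sumr_const prod_nat_const card_ord.
Qed.

Lemma rc_rigidity_kron_le (M : forall i, 'M[F]_(d i)) D gamma :
  (forall i, 0 < d i <= D)%N ->
  2 * (gamma * ln n) <= tail_exponent d w hi delta ->
  (rc_rigidity (kronmx M) (2 * D%:R * powR n (1 - gamma)))%:R <=
  sparsity ^+ (D + D).
Proof.
move=> dD gammaT; set r := 2 * D%:R * _.
have n_gt0 : 0 < n by rewrite ltr0n prodn_gt0 // => i; have /andP[] := dD i.
have rE : r = 2 * D%:R * n * expR (- (gamma * ln n)).
  by rewrite /r /powR gt_eqF // mulrBl mul1r expRD lnK // mulrA.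
(* If r < n then n ^ gamma > 2 D, which absorbs the factor 2 lost to having two
   tails. *)
have [nr|rn] := leP n r.
  by rewrite rc_rigidity_eq0 // exprn_ge0 ?expR_ge0.
apply: (@le_trans _ _ (Num.truncn sparsity ^ (D + D))%N%:R); last first.
  by rewrite natrX lerXn2r ?nnegrE ?ler0n ?expR_ge0 // truncn_le expR_ge0.
rewrite ler_nat; apply: rc_rigidity_le.
apply: rc_reducible_le (rc_reducible_kron M dD).
have [D0|D_gt0] := posnP D; first by rewrite rE D0 mulr0 !mul0r.
set x := expR (- (gamma * ln n)) in rE.
have x0 : 0 < x := expR_gt0 _.
have x_small : 2 * x <= 1.
  have D1 : 1 <= D%:R :> R by rewrite ler1n.
  have : 2 * D%:R * x <= 1.
    by rewrite -(ler_pM2l n_gt0) mulr1 mulrC mulrAC -rE ltW.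
  by apply: le_trans; rewrite ler_pM2r // ler_peMr.
have tail_le : expR (- tail_exponent d w hi delta) <= x * x.
  by rewrite -expRD ler_expR; lra.
have -> : (2 * deleted) *+ (D + D) =
    2 * D%:R * n * (2 * expR (- tail_exponent d w hi delta)).
  by rewrite /deleted -mulr_natr natrD; ring.
rewrite rE ler_wpM2l ?mulr_ge0 ?(ltW n_gt0) //.
apply: (@le_trans _ _ (2 * (x * x))); first by rewrite ler_pM2l.
by rewrite mulrA ler_piMl // ltW.
Qed.

End KroneckerRigidity.

(** * Choice of the parameters *)

Section LogarithmBounds.
Variable R : realType.
Implicit Type x : R.

Lemma ln_ge_half x : 2 <= x -> 1 / 2 <= ln x.
Proof.
move=> x2; have -> : x = x^-1^-1 by rewrite invrK.
have x0 : 0 < x by lra.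
have xV : x^-1 <= 1 / 2 by rewrite -[1 / 2]invrK lef_pV2 ?posrE ?invr_gt0; lra.
rewrite lnV ?posrE ?invr_gt0 // lerNr -[x^-1](subrKC 1).
have xV0 : 0 < x^-1 by rewrite invr_gt0.
by apply: (le_trans (le_ln1Dx _)); lra.
Qed.

Lemma ln_prod (I : Type) (r : seq I) (P : pred I) (f : I -> R) :
  (forall i, P i -> 0 < f i) ->
  ln (\prod_(i <- r | P i) f i) = \sum_(i <- r | P i) ln (f i).
Proof.
move=> f0; suff [] : 0 < \prod_(i <- r | P i) f i /\
  ln (\prod_(i <- r | P i) f i) = \sum_(i <- r | P i) ln (f i) by [].
elim/big_rec2: _ => [|i y x Pi [x0 <-]]; first by rewrite ln1.
by rewrite mulr_gt0 ?f0 // lnM ?posrE ?f0.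
Qed.

Definition deviation_rate (l0 : R) : R := (28 / l0 + 16)^-1.

(* The relative deviation is [deviation / K]; dividing by [lK := ln (K / eps)]
   absorbs the entropy term [a * ln a^-1]. *)
Definition deviation (l0 eps lK : R) : R := deviation_rate l0 ^+ 2 * eps / lK.

Lemma deviation_rate_gt0 (l0 : R) : 0 < l0 -> 0 < deviation_rate l0.
Proof. by move=> l0_gt0; rewrite invr_gt0 addr_gt0 // divr_gt0. Qed.

Lemma deviation_bounds (l0 eps lK : R) (a := deviation l0 eps lK) :
  0 < eps < 1 -> 0 < l0 <= ln eps^-1 -> ln eps^-1 <= lK ->
  0 < a <= 1 /\ 12 * a + 8 * (a * ln a^-1) <= eps.
Proof.
move=> /andP[eps_gt0 eps_lt1] /andP[l0_gt0 l0e] elK.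
have s_gt0 := deviation_rate_gt0 l0_gt0; have lK_gt0 : 0 < lK by lra.
set s := deviation_rate l0 in s_gt0; have aE : a = s ^+ 2 * eps / lK by [].
have rate_normalized : 28 * (s / l0) + 16 * s = 1.
  have -> : 28 * (s / l0) + 16 * s = s * (28 / l0 + 16) by ring.
  by rewrite mulVf // gt_eqF // addr_gt0 // divr_gt0.
have s_l0_gt0 : 0 < s / l0 by rewrite divr_gt0.
have s_lK_gt0 : 0 < s / lK by rewrite divr_gt0.
have s_lK_le : s / lK <= s / l0 by rewrite ler_pM2l // lef_pV2 ?posrE //; lra.
have s2_lK_le : s * (s / lK) <= s / lK by rewrite ler_piMl ?ltW //; lra.
have s2_le : s * s <= s by rewrite ler_piMl ?ltW //; lra.
have a_gt0 : 0 < a by rewrite aE divr_gt0 // mulr_gt0 // exprn_gt0.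
have a_factor : a = eps * (s * (s / lK)) by rewrite aE; ring.
have ln_aV_le : ln a^-1 <= 2 * s^-1 + 2 * lK.
  have -> : a^-1 = s^-1 ^+ 2 * (eps^-1 * lK).
    by rewrite aE; field; rewrite !gt_eqF.
  have sV_gt0 : 0 < s^-1 by rewrite invr_gt0.
  have epsV_gt0 : 0 < eps^-1 by rewrite invr_gt0.
  rewrite !lnM ?posrE ?mulr_gt0 ?exprn_gt0 //.
  by have := ln_sublinear sV_gt0; have := ln_sublinear lK_gt0; lra.
split.
  rewrite a_gt0 a_factor; apply: le_trans (ltW eps_lt1).
  by rewrite ler_piMr ?(ltW eps_gt0) //; lra.
apply: (@le_trans _ _ (12 * a + 8 * (a * (2 * s^-1 + 2 * lK)))).
  by rewrite lerD2l ler_pM2l // ler_pM2l.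
have -> : 12 * a + 8 * (a * (2 * s^-1 + 2 * lK)) =
    eps * (12 * (s * (s / lK)) + 16 * (s / lK) + 16 * (s * s)).
  by rewrite aE; field; rewrite !gt_eqF.
by rewrite ler_piMr ?(ltW eps_gt0) //; lra.
Qed.

Lemma sparsity_exponent_le (N D a S m : R) :
  0 <= N -> 2 <= D -> 0 < a <= 1 -> m <= 2 * a * (N / (ln D * D)) ->
  S <= 2 * N * D ->
  (D + D) * (ln (D ^+ 2 / a) * m + S * expR (- ln (D ^+ 2 / a))) <=
  (12 * a + 8 * (a * ln a^-1)) * N.
Proof.
move=> N0 D2 /andP[a0 a1] mN SN.
have D0 : 0 < D by lra.
have lD2 := ln_ge_half D2; have lD0 : 0 < ln D by lra.
have la0 : 0 <= ln a^-1 by rewrite ln_ge0 // invf_ge1.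
have D2a0 : 0 < D ^+ 2 / a by rewrite divr_gt0 // exprn_gt0.
have thetaE : ln (D ^+ 2 / a) = 2 * ln D + ln a^-1.
  by rewrite lnM ?posrE ?exprn_gt0 ?invr_gt0 // lnXn // mulr_natl.
have distance_le : ln (D ^+ 2 / a) * m <=
    (2 * ln D + ln a^-1) * (2 * a * (N / (ln D * D))).
  by rewrite thetaE ler_wpM2l // addr_ge0 // mulr_ge0 // ltW.
have volume_le : S * expR (- ln (D ^+ 2 / a)) <= 2 * N * D * (a / D ^+ 2).
  rewrite expRN lnK ?posrE // invf_div ler_wpM2r // ltW //.
  by rewrite divr_gt0 // exprn_gt0.
apply: (@le_trans _ _ ((D + D) *
    ((2 * ln D + ln a^-1) * (2 * a * (N / (ln D * D))) +
     2 * N * D * (a / D ^+ 2)))).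
  by rewrite ler_pM2l ?lerD // addr_gt0.
have -> : (D + D) *
    ((2 * ln D + ln a^-1) * (2 * a * (N / (ln D * D))) +
     2 * N * D * (a / D ^+ 2)) =
    (12 * a + 4 * (a * (ln a^-1 / ln D))) * N.
  by field; rewrite !gt_eqF.
rewrite ler_wpM2r // lerD2l.
have : ln a^-1 / ln D <= 2 * ln a^-1.
  rewrite ler_pdivrMr // mulrAC -[leLHS]mul1r ler_wpM2r //; lra.
by move=> /(ler_wpM2l (ltW a0)); lra.
Qed.

End LogarithmBounds.

Section ParametrizedBound.
Variables (R : realType) (k : nat) (d : 'I_k.+1 -> nat) (D : nat).
Hypothesis d_bounds : forall i, (2 <= d i <= D)%N.
Variables (w : 'I_k.+1 -> R) (lo hi K L : R).
Hypotheses (lo_gt0 : 0 < lo) (le_lo_hi : lo <= hi).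
Hypothesis w_bounds : forall i, lo <= w i <= hi.

Let n : R := (\prod_(i < k.+1) d i)%N%:R.
Let DR : R := D%:R.

Let D_ge2 : 2 <= DR.
Proof.
by have /andP[d2 dD] := d_bounds ord0; rewrite ler_nat (leq_trans d2).
Qed.

Let d_bounds_real i : 2 <= ((d i)%:R : R) <= DR.
Proof. by have /andP[d2 dD] := d_bounds i; rewrite !ler_nat d2. Qed.

Lemma ln_prod_dims : ln n = \sum_i ln (d i)%:R.
Proof.
rewrite /n natr_prod ln_prod // => i _.
by have /andP[d2 _] := d_bounds_real i; lra.
Qed.

Lemma ln_prod_dims_ge0 : 0 <= ln n.
Proof.
rewrite ln_prod_dims; apply: sumr_ge0 => i _.
by have /andP[/ln_ge_half] := d_bounds_real i; lra.
Qed.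

Lemma sum_log_ratio : \sum_i ln (d i)%:R / ln DR = ln n / ln DR.
Proof. by rewrite ln_prod_dims mulr_suml. Qed.

Lemma sum_dims_le : (\sum_i d i)%N%:R <= 2 * ln n * DR.
Proof.
rewrite natr_sum ln_prod_dims mulr_sumr mulr_suml; apply: ler_sum => i _.
have /andP[d2 dD] := d_bounds_real i; apply: (le_trans dD).
by rewrite ler_peMl //; have := ln_ge_half d2; lra.
Qed.

Hypothesis mean_weight_le :
  mean_weight d w <= K * (\sum_i ln (d i)%:R / ln DR) * (lo / DR).

Lemma mean_weight_ratio_ge1 : 1 <= K.
Proof.
pose T : R := \sum_i ln (d i)%:R / ln DR.
have lD0 : 0 < ln DR by have := ln_ge_half D_ge2; lra.
have T0 : 0 < T.
  rewrite /T -mulr_suml divr_gt0 // (bigD1 ord0) //= ltr_pwDl //.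
    by have /andP[/ln_ge_half] := d_bounds_real ord0; lra.
  by apply: sumr_ge0 => i _; have /andP[/ln_ge_half] := d_bounds_real i; lra.
have c0 : 0 < lo / DR by rewrite divr_gt0 //; have := D_ge2; lra.
rewrite -(ler_pM2r T0) -(ler_pM2r c0) mul1r; apply: le_trans mean_weight_le.
rewrite mulr_suml; apply: ler_sum => i _.
have /andP[d2 dD] := d_bounds_real i; have /andP[wlo _] := w_bounds i.
have d0 : 0 < (d i)%:R :> R by lra.
apply: (@le_trans _ _ (lo / DR)).
  by rewrite ler_piMl ?(ltW c0) // ler_pdivrMr // mul1r ler_ln ?posrE //; lra.
by apply: ler_pM; rewrite ?(ltW lo_gt0) ?invr_ge0 ?lef_pV2 ?posrE //; lra.
Qed.

Hypothesis mean_weight_ge :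
  L * (\sum_i ln (d i)%:R / ln DR) * (hi / DR) <= mean_weight d w.

Lemma tail_exponent_ge (a : R) :
  2 * (L * a ^+ 2 / (16 * (DR * ln DR * K ^+ 2)) * ln n) <=
  tail_exponent d w hi (a / K).
Proof.
have K1 := mean_weight_ratio_ge1; have lnDR := ln_ge_half D_ge2.
have hi_gt0 := lt_le_trans lo_gt0 le_lo_hi.
rewrite /tail_exponent ler_pdivlMr ?mulr_gt0 //.
have -> : 2 * (L * a ^+ 2 / (16 * (DR * ln DR * K ^+ 2)) * ln n) * (8 * hi) =
    (a / K) ^+ 2 * (L * (ln n / ln DR) * (hi / DR)).
  by have D2 := D_ge2; field; rewrite !gt_eqF //; lra.
by rewrite ler_wpM2l ?sqr_ge0 // -sum_log_ratio.
Qed.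

Lemma scaled_mean_weight_le (a : R) : 0 <= a ->
  2 * (a / K) * mean_weight d w / lo <= 2 * a * (ln n / (ln DR * DR)).
Proof.
move=> a_ge0; have K1 := mean_weight_ratio_ge1; have lnDR := ln_ge_half D_ge2.
rewrite ler_pdivrMr //.
have -> : 2 * a * (ln n / (ln DR * DR)) * lo =
    2 * (a / K) * (K * (ln n / ln DR) * (lo / DR)).
  by have D2 := D_ge2; field; rewrite !gt_eqF //; lra.
rewrite ler_wpM2l -?sum_log_ratio // mulr_ge0 // divr_ge0 //; lra.
Qed.

Lemma rc_rigidity_kron_le_powR (F : fieldType) (M : forall i, 'M[F]_(d i))
    (a eps : R) :
  0 < a <= 1 -> 12 * a + 8 * (a * ln a^-1) <= eps ->
  (rc_rigidity (kronmx M)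
    (2 * DR * powR n (1 - L * a ^+ 2 / (16 * (DR * ln DR * K ^+ 2)))))%:R <=
  powR n eps.
Proof.
move=> a_bounds a_le; have /andP[a_gt0 a_le1] := a_bounds.
have K1 := mean_weight_ratio_ge1; have D2 := D_ge2.
have delta_bounds : 0 <= a / K <= 1.
  have K_gt0 : 0 < K by lra.
  rewrite divr_ge0 ?(ltW a_gt0) ?(ltW K_gt0) // ler_pdivrMr // mul1r.
  exact: le_trans K1.
have theta_ge0 : 0 <= ln (DR ^+ 2 / a).
  by rewrite ln_ge0 // ler_pdivlMr // mul1r; apply: (le_trans a_le1); nra.
have dD i : (0 < d i <= D)%N by have /andP[/ltnW ->] := d_bounds i.
have n_gt0 : 0 < n by rewrite ltr0n prodn_gt0 // => i; have /andP[] := dD i.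
apply: le_trans (rc_rigidity_kron_le lo_gt0 le_lo_hi w_bounds delta_bounds
  theta_ge0 M dD (tail_exponent_ge a)) _.
rewrite /hamming_ball_bound -expRM_natl /powR gt_eqF // ler_expR natrD.
apply: le_trans (ler_wpM2r ln_prod_dims_ge0 a_le).
apply: sparsity_exponent_le ln_prod_dims_ge0 D2 a_bounds _ sum_dims_le.
exact: scaled_mean_weight_le (ltW a_gt0).
Qed.

Lemma rc_rigidity_kron_le_powR_rate (F : fieldType) (M : forall i, 'M[F]_(d i))
    (l0 eps : R) (c := deviation_rate l0 ^+ 4 / 16) :
  0 < eps < 1 -> 0 < l0 <= ln eps^-1 ->
  (rc_rigidity (kronmx M) (2 * DR * powR n
    (1 - c * L * eps ^+ 2 / (DR * ln DR * K ^+ 2 * ln (K / eps) ^+ 2))))%:R <=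
  powR n eps.
Proof.
move=> eps01 l0_bounds; have /andP[eps_gt0 _] := eps01.
have K1 := mean_weight_ratio_ge1; have ln_DR := ln_ge_half D_ge2.
have lK : ln eps^-1 <= ln (K / eps).
  rewrite ler_ln ?posrE ?divr_gt0 ?invr_gt0 //; last by lra.
  by rewrite ler_peMl // ltW // invr_gt0.
have lK_gt0 : 0 < ln (K / eps) by have /andP[] := l0_bounds; lra.
have [a_bounds a_le] := deviation_bounds eps01 l0_bounds lK.
have := rc_rigidity_kron_le_powR M a_bounds a_le.
suff -> : L * deviation l0 eps (ln (K / eps)) ^+ 2 /
    (16 * (DR * ln DR * K ^+ 2)) =
  c * L * eps ^+ 2 / (DR * ln DR * K ^+ 2 * ln (K / eps) ^+ 2) by [].
have D2 := D_ge2; rewrite /c /deviation; field.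
by rewrite !gt_eqF //; lra.
Qed.

End ParametrizedBound.

(* The constant c is uniform in eps and w as long as eps stays below a fixed
   eps0 < 1. It cannot be uniform on all of ]0, 1[: gamma is unbounded when
   K = 1 and eps tends to 1. Taking eps0 = eps covers every eps in ]0, 1[. *)
Theorem theorem5p1 (R : realType) (eps0 : R) (eps0_lt1 : eps0 < 1) :
  exists c : R, 0 < c /\
  forall (eps : R) (w : R -> R),
    0 < eps -> eps <= eps0 ->
    {homo w : x y / x <= y} -> (forall x, 1 <= w x) ->
  forall (k : nat) (d : 'I_k.+1 -> nat) (L K : R),
    (forall i, (2 <= d i)%N) ->
    (forall i j : 'I_k.+1, (i <= j)%N -> (d i <= d j)%N) ->
    0 < L -> 0 < K ->
  let d1 : R := (d ord0)%:R in
  let dk : R := (d ord_max)%:R in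
    \sum_(i < k.+1) w (d i)%:R / (d i)%:R
      <= K * (\sum_(i < k.+1) ln ((d i)%:R : R) / ln dk) * (w d1 / dk) ->
    \sum_(i < k.+1) w (d i)%:R / (d i)%:R
      >= L * (\sum_(i < k.+1) ln ((d i)%:R : R) / ln dk) * (w dk / dk) ->
  forall (F : fieldType) (M : forall i : 'I_k.+1, 'M[F]_(d i)),
  let n : R := (\prod_(i < k.+1) d i)%N%:R in
  let gamma : R :=
    c * L * eps ^+ 2 / (dk * ln dk * K ^+ 2 * ln (K / eps) ^+ 2) in
  (rc_rigidity (kronmx M) (2 * dk * powR n (1 - gamma)))%:R <= powR n eps.
Proof.
pose e1 := Num.max eps0 (1 / 2); pose l0 := ln e1^-1.
have e1_gt0 : 0 < e1 by rewrite lt_max; apply/orP; right; lra.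
have e1_lt1 : e1 < 1 by rewrite gt_max eps0_lt1; lra.
have l0_gt0 : 0 < l0 by rewrite ln_gt0 // invf_gt1.
exists (deviation_rate l0 ^+ 4 / 16); split.
  by rewrite divr_gt0 // exprn_gt0 // deviation_rate_gt0.
move=> eps w eps_gt0 eps_le w_homo w_ge1 k d L K d_ge2 d_homo _ _ d1 dk.
move=> mu_le mu_ge F M.
have eps_le1 : eps <= e1 by rewrite le_max eps_le.
have eps01 : 0 < eps < 1 by rewrite eps_gt0 (le_lt_trans eps_le1).
have l0_bounds : 0 < l0 <= ln eps^-1.
  by rewrite l0_gt0 ler_ln ?posrE ?invr_gt0 // lef_pV2 ?posrE.
have d_bounds i : (2 <= d i <= d ord_max)%N by rewrite d_ge2 d_homo // -ltnS.
have w_gt0 : 0 < w d1 by apply: lt_le_trans (w_ge1 _).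
have w_bounds i : w d1 <= w (d i)%:R <= w dk.
  by apply/andP; split; apply: w_homo; rewrite ler_nat d_homo // -ltnS.
have w_d1_dk : w d1 <= w dk by have /andP[_] := w_bounds ord0.
by have := rc_rigidity_kron_le_powR_rate d_bounds w_gt0 w_d1_dk w_bounds
  mu_le mu_ge M eps01 l0_bounds.
Qed.
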